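(* Let $(M,F)$ be a Finsler manifold admitting a concurrent $\pi$-vector field $\overline{\varphi}$ with associated $\pi$-form $\phi=i_{\overline{\varphi}}g$; put $\Phi=\phi(\overline{\eta})$ and $p^2=g(\overline\varphi,\overline\varphi)$. Let $\widehat F=\frac{F^2}{F-\Phi}$ on $\mathcal D=\{(x,y)\in TM : F(x,y)>\Phi(x,y)\}$ be a generalized $\phi$-Matsumoto metric (i.e. a conic pseudo-Finsler structure), with $F(1+2p^2)-3\Phi\ne0$ on $\mathcal D$. Then the $\pi$-vector field $\overline\varphi$ cannot be concurrent with respect to $\widehat F$.
   Context: Setting. $M$ is an $n$-dimensional paracompact smooth manifold, $\pi:TM\to M$ its tangent bundle, $\mathcal TM=TM\setminus\{0\}$ the slit tangent bundle. $\pi$-vector fields are smooth sections of the pullback of the bundle $TM\to M$ over $\mathcal TM$ (local basis $\overline{\partial}_i$); $\pi$-forms/tensors are the corresponding (dual) tensor sections. $\gamma$ is the natural injection (vertical lift) $\gamma(W^i\overline\partial_i)=W^i\partial_{y^i}$, $\rho(a^i\partial_{x^i}+b^i\partial_{y^i})=a^i\overline\partial_i$, $J=\gamma\circ\rho$, $\overline\eta(u)=(u,u)$ (i.e. $\overline\eta=y^i\overline\partial_i$), $\mathcal C=\gamma\overline\eta$, and $d_Jf=df\circ J$ for functions $f$. Finsler structure: $F:TM\to[0,\infty)$, $C^\infty$ on $\mathcal TM$, $C^0$ on $TM$, positively homogeneous of degree 1 in $y$, with $dd_JE$ of maximal rank, $E=\frac12F^2$. Metric tensor: $g(\rho W,\rho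 Z)=dd_JE(JW,Z)$ (it is positive definite). Geodesic spray $G$: the vector field with $JG=\mathcal C$, $[\mathcal C,G]=G$, $i_Gdd_JE=-dE$. Barthel connection $\Gamma=[J,G]$ (i.e. $\Gamma X=[JX,G]-J[X,G]$), projectors $h=\frac12(I+\Gamma)$, $v=\frac12(I-\Gamma)$, horizontal map $\beta=(\rho|_{\mathrm{Im}\,h})^{-1}$. Berwald connection $D^\circ$: $\gamma D^\circ_{hZ}\rho W=v[hZ,JW]$, $D^\circ_{\gamma\overline Z}\overline W=\rho[\gamma\overline Z,\beta\overline W]$. Cartan connection $\nabla$: determined by $2g(\nabla_{\gamma\overline X}\overline Y,\overline Z)=\gamma\overline X\cdot g(\overline Y,\overline Z)+g(\overline Y,\rho[\beta\overline Z,\gamma\overline X])+g(\overline Z,\rho[\gamma\overline X,\beta\overline Y])$ and $2g(\nabla_{\beta\overline X}\overline Y,\overline Z)=\beta\overline X\cdot g(\overline Y,\overline Z)+\beta\overline Y\cdot g(\overline Z,\overline X)-\beta\overline Z\cdot g(\overline X,\overline Y)-g(\overline X,\rho[\beta\overline Y,\beta\overline Z])+g(\overline Y,\rho[\beta\overline Z,\beta\overline X])+g(\overline Z,\rho[\beta\overline X,\beta\overline Y])$. Concurrent $\pi$-vector field with respect to $F$: a non-vanishing $\pi$-vector field $\overline\varphi$ with $\nabla_{\beta\overline W}\overline\varphi=-\overline W=D^\circ_{\beta\overline W}\overline\varphi$ and $\nabla_{\gamma\overline W}\overline\varphi=0=D^\circ_{\gamma\overline W}\overline\varphi$ for all $\overline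 W$. Concurrent with respect to $\widehat F$: the same conditions on $\mathcal D$ with $\widehat\nabla,\widehat D^\circ,\widehat\beta$ in place of $\nabla,D^\circ,\beta$. Conic pseudo-Finsler structure on $M$: a smooth function to $[0,\infty)$ on a conic sub-bundle $\mathcal D\subset\mathcal TM$ (non-empty, open, invariant under scaling by positive reals, $\pi(\mathcal D)=M$, each fibre $\mathcal D_x$ connected), positively 1-homogeneous in $y$, whose form $dd_J(\frac12(\cdot)^2)$ has maximal rank. For the conic pseudo-Finsler structure $\widehat F$, the energy $\widehat E=\frac12\widehat F^2$, metric tensor $\widehat g$, geodesic spray $\widehat G$, Barthel connection $\widehat\Gamma$, projectors $\widehat h,\widehat v$, horizontal map $\widehat\beta$, Berwald connection $\widehat D^\circ$ and Cartan connection $\widehat\nabla$ are defined on $\mathcal D$ by the same formulas as the corresponding unhatted objects of $F$. *)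

(* Defs.v *)
From HB Require Import structures.
From mathcomp Require Import all_boot all_order all_algebra.
From mathcomp Require Import all_classical all_reals all_analysis.
Import Order.TTheory GRing.Theory Num.Theory numFieldNormedType.Exports.
Set Implicit Arguments.
Unset Strict Implicit.
Unset Printing Implicit Defensive.
Local Open Scope classical_set_scope.
Local Open Scope ring_scope.

(** * Smooth maps between finite-dimensional spaces *)

(* [f] is of class C^k at the points of [A]; used with [A] open. In finite
   dimension this is the usual notion: all iterated directional derivatives of
   order at most [k] exist and are continuous on [A]. *)
Fixpoint classC (R : realType) (V W : normedModType R) (k : nat)
    (A : set V) (f : V -> W) : Prop :=
  match k with
  | 0%N => forall x, A x -> {for x, continuous f}
  | k.+1 => (forall x, A x -> differentiable f x) /\
            (forall v, classC k A (fun x => 'D_v f x))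
  end.

Definition smooth (R : realType) (V W : normedModType R)
    (A : set V) (f : V -> W) : Prop := forall k, classC k A f.

(** * Paracompact smooth manifolds *)

Definition open_cover (M : topologicalType) (C : set (set M)) : Prop :=
  (forall A, C A -> open A) /\ (forall x, exists2 A, C A & A x).

Definition paracompact (M : topologicalType) : Prop :=
  hausdorff_space M /\
  forall C : set (set M), open_cover C ->
    exists C' : set (set M),
      [/\ open_cover C',
          (forall B, C' B -> exists2 A, C A & B `<=` A) &
          (forall x : M, exists2 N, nbhs x N &
             finite_set [set B | C' B /\ B `&` N !=set0])].

(* The smooth structure is given by an atlas; [chart_inv c] is only meaningful
   on the coordinate domain [chart_map c @` chart_dom c], and [chart_at x] is a
   chart around [x]. *)
Record manifold (R : realType) (n : nat) := Manifold {
  carrier :> topologicalType;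
  chart : Type;
  chart_dom : chart -> set carrier;
  chart_map : chart -> carrier -> 'rV[R]_n;
  chart_inv : chart -> 'rV[R]_n -> carrier;
  chart_at : carrier -> chart;
  chart_atP : forall x, chart_dom (chart_at x) x;
  chart_dom_open : forall c, open (chart_dom c);
  chart_img_open : forall c, open (chart_map c @` chart_dom c);
  chart_mapK : forall c x, chart_dom c x -> chart_inv c (chart_map c x) = x;
  chart_map_cont : forall c x, chart_dom c x -> {for x, continuous (chart_map c)};
  chart_inv_cont : forall c z, (chart_map c @` chart_dom c) z ->
    {for z, continuous (chart_inv c)};
  transition_smooth : forall c d,
    smooth (chart_map c @` (chart_dom c `&` chart_dom d))
           (chart_map d \o chart_inv c);
  carrier_paracompact : paracompact carrier }.

Definition transition (R : realType) (n : nat) (M : manifold R n)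
    (c d : chart M) : 'rV[R]_n -> 'rV[R]_n := chart_map d \o chart_inv c.

(** * The tangent bundle *)

(* A tangent vector at [x] is the family of its components in the charts
   around [x], related by the differentials of the transition maps; the
   components in the other charts are set to 0 so that equality is the
   expected one. *)
Definition tangent_law (R : realType) (n : nat) (M : manifold R n) (x : M)
    (v : chart M -> 'rV[R]_n) : Prop :=
  (forall c d, chart_dom c x -> chart_dom d x ->
     v d = 'd (transition c d) (chart_map c x) (v c)) /\
  (forall c, ~ chart_dom c x -> v c = 0).

Record tangent (R : realType) (n : nat) (M : manifold R n) := Tangent {
  footpoint : M;
  component : chart M -> 'rV[R]_n;
  tangentP : tangent_law footpoint component }.

Lemma tangent_of_law (R : realType) (n : nat) (M : manifold R n)
    (c : chart M) (x : M) (v : 'rV[R]_n) :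
  tangent_law x (fun d => if `[< chart_dom c x /\ chart_dom d x >]
                          then 'd (transition c d) (chart_map c x) v else 0).
Proof.
have diff_tr (a b : chart M) y : chart_dom a y -> chart_dom b y ->
    differentiable (transition a b) (chart_map a y).
  by move=> ya yb; have [+ _] := @transition_smooth _ _ M a b 1%N; apply; exists y.
split=> [d e xd xe|d xd]; last by case: asboolP => // -[].
case: (pselect (chart_dom c x)) => xc; last first.
  by rewrite !asboolF ?linear0 // => -[].
rewrite !asboolT //.
have trx : transition c d (chart_map c x) = chart_map d x.
  by rewrite /transition /= chart_mapK.
have dcd := diff_tr _ _ _ xc xd; have dce := diff_tr _ _ _ xc xe.
have dde : differentiable (transition d e) (transition c d (chart_map c x)).
  by rewrite trx; exact: diff_tr.
pose f := transition d e \o transition c d.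
have df : differentiable f (chart_map c x) by exact: differentiable_comp.
have dfE := congr1 (fun g : 'rV[R]_n -> 'rV[R]_n => g v) (diff_comp dcd dde).
cbv beta in dfE.
have trE : 'd (transition d e) (transition c d (chart_map c x)) =
           'd (transition d e) (chart_map d x) by rewrite trx.
rewrite -trE; apply: etrans dfE.
apply: (etrans (esym (deriveE v dce))).
apply: etrans (deriveE v df).
apply: near_eq_derive.
have img : (chart_map c @` chart_dom c) (chart_map c x) by exists x.
have nd : nbhs (chart_inv c (chart_map c x)) (chart_dom d).
  rewrite (chart_mapK xc); apply: open_nbhs_nbhs.
  exact: (conj (chart_dom_open d) xd).
have nz : nbhs (chart_map c x) [set z | chart_dom d (chart_inv c z)].
  exact: (@chart_inv_cont _ _ M c _ img (chart_dom d) nd).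
apply: filterS nz => z zd.
by rewrite /f /transition /= (chart_mapK zd).
Qed.

(* The tangent vector at [x] with components [v] in the chart [c]. *)
Definition tangent_of (R : realType) (n : nat) (M : manifold R n)
    (c : chart M) (x : M) (v : 'rV[R]_n) : tangent M :=
  Tangent (tangent_of_law c x v).

Lemma tangent_scale_law (R : realType) (n : nat) (M : manifold R n)
    (a : R) (u : tangent M) :
  tangent_law (footpoint u) (fun c => a *: component u c).
Proof.
have [law zero] := tangentP u.
split=> [c d uc ud|c uc]; first by rewrite (law c d uc ud) linearZ.
by rewrite zero ?scaler0.
Qed.

Definition tangent_scale (R : realType) (n : nat) (M : manifold R n)
    (a : R) (u : tangent M) : tangent M :=
  Tangent (tangent_scale_law a u).

Definition slit (R : realType) (n : nat) (M : manifold R n) : set (tangent M) :=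
  [set u | exists c, component u c != 0].

(* Coordinates (x, y) on the tangent bundle, and coordinate expressions of
   subsets of TM, functions on TM and pi-vector fields. *)
Definition tm_coords (R : realType) (n : nat) : normedModType R :=
  ('rV[R]_n * 'rV[R]_n)%type.

Section Local.
Variables (R : realType) (n : nat) (M : manifold R n).

Definition tm_coord (c : chart M) (u : tangent M) : tm_coords R n :=
  (chart_map c (footpoint u), component u c).

Definition tm_point (c : chart M) (z : tm_coords R n) : tangent M :=
  tangent_of c (chart_inv c z.1) z.2.

Definition loc_set (D : set (tangent M)) (c : chart M) : set (tm_coords R n) :=
  [set z | (chart_map c @` chart_dom c) z.1 /\ D (tm_point c z)].

Definition loc_fun (f : tangent M -> R) (c : chart M) : tm_coords R n -> R :=
  fun z => f (tm_point c z).

Definition loc_field (phi : tangent M -> tangent M) (c : chart M) :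
    tm_coords R n -> 'rV[R]_n :=
  fun z => component (phi (tm_point c z)) c.

Definition pi_vector_field (D : set (tangent M)) (phi : tangent M -> tangent M) :
    Prop :=
  (forall u, D u -> footpoint (phi u) = footpoint u) /\
  (forall c, smooth (loc_set D c) (loc_field phi c)).

End Local.

(** * Coordinate expressions on an open subset of R^n x R^n *)

Section Coordinates.
Variables (R : realType) (n : nat).
Notation V := 'rV[R]_n.
Notation P := (tm_coords R n).
Implicit Types (E f : P -> R) (G : P -> P) (U : set P).

(* A tangent vector (a, b) of TM stands for a^i d/dx^i + b^i d/dy^i. *)
Definition bracket (X Y : P -> P) : P -> P :=
  fun z => 'D_(X z) Y z - 'D_(Y z) X z.

Definition gamma (w : V) : P := (0, w).
Definition rho (a : P) : V := a.1.
Definition J (a : P) : P := gamma (rho a).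
Definition etabar (z : P) : V := z.2.
Definition liouville (z : P) : P := gamma (etabar z).

Definition energy (F : P -> R) : P -> R := fun z => 2^-1 * F z ^+ 2.

Definition dJ f : P -> P -> R := fun z a => 'D_(J a) f z.

(* Exterior derivative of the 1-form [w], evaluated on constant vector fields
   (whose bracket vanishes). *)
Definition dform (w : P -> P -> R) : P -> P -> P -> R :=
  fun z a b => 'D_a (w^~ b) z - 'D_b (w^~ a) z.

Definition ddJ f : P -> P -> P -> R := dform (dJ f).

(* The 2-form [w] has rank 2n, i.e. a |-> i_a w is injective. *)
Definition maximal_rank (w : P -> P -> R) : Prop :=
  forall a, (forall b, w a b = 0) -> a = 0.

(* g(rho W, rho Z) = dd_J E(JW, Z) with rho W = a and Z = (b, 0); the value does
   not depend on the vertical part of Z. *)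
Definition metric E : P -> V -> V -> R :=
  fun z a b => ddJ E z (gamma a) (b, 0).

Definition geodesic_spray_on U E G : Prop :=
  smooth U G /\
  forall z, U z ->
    [/\ J (G z) = liouville z,
        bracket liouville G z = G z &
        forall b, ddJ E z (G z) b = - 'D_b E z].

(* Gamma X = [JX, G] - J[X, G]; it is tensorial in X, so it is evaluated on the
   constant vector field with value [a]. *)
Definition barthel G : P -> P -> P :=
  fun z a => bracket (cst (J a)) G z - J (bracket (cst a) G z).

Definition hproj G : P -> P -> P := fun z a => 2^-1 *: (a + barthel G z a).
Definition vproj G : P -> P -> P := fun z a => 2^-1 *: (a - barthel G z a).

(* beta = (rho|Im h)^-1 *)
Definition beta G : P -> V -> P :=
  fun z w => xget 0 [set a | (exists b, a = hproj G z b) /\ rho a = w].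

Definition vlift (W : P -> V) : P -> P := fun z => gamma (W z).
Definition hlift G (W : P -> V) : P -> P := fun z => beta G z (W z).

(* The connections are stated as relations: [C] is the derivative of the
   pi-vector field [Y] along [vlift X] or [hlift G X]. Since gamma is injective
   and the metric is nondegenerate, [C] is unique on [U]. *)
Definition berwald_v U G (X Y C : P -> V) : Prop :=
  forall z, U z -> C z = rho (bracket (vlift X) (hlift G Y) z).

Definition berwald_h U G (X Y C : P -> V) : Prop :=
  forall z, U z ->
    gamma (C z) = vproj G z (bracket (hlift G X) (vlift Y) z).

Definition cartan_v U E G (X Y C : P -> V) : Prop :=
  let g := metric E in
  forall Z : P -> V, smooth U Z -> forall z, U z ->
    2 * g z (C z) (Z z) =
      'D_(vlift X z) (fun t => g t (Y t) (Z t)) z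
      + g z (Y z) (rho (bracket (hlift G Z) (vlift X) z))
      + g z (Z z) (rho (bracket (vlift X) (hlift G Y) z)).

Definition cartan_h U E G (X Y C : P -> V) : Prop :=
  let g := metric E in
  forall Z : P -> V, smooth U Z -> forall z, U z ->
    2 * g z (C z) (Z z) =
      'D_(hlift G X z) (fun t => g t (Y t) (Z t)) z
      + 'D_(hlift G Y z) (fun t => g t (Z t) (X t)) z
      - 'D_(hlift G Z z) (fun t => g t (X t) (Y t)) z
      - g z (X z) (rho (bracket (hlift G Y) (hlift G Z) z))
      + g z (Y z) (rho (bracket (hlift G Z) (hlift G X) z))
      + g z (Z z) (rho (bracket (hlift G X) (hlift G Y) z)).

Definition concurrent_on U E G (phi : P -> V) : Prop :=
  forall W : P -> V, smooth U W ->
    [/\ cartan_h U E G W phi (fun z => - W z),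
        berwald_h U G W phi (fun z => - W z),
        cartan_v U E G W phi (cst 0) &
        berwald_v U G W phi (cst 0)].

End Coordinates.

(** * Finsler and conic pseudo-Finsler structures *)

Section Finsler.
Variables (R : realType) (n : nat) (M : manifold R n).
Implicit Types (F : tangent M -> R) (D : set (tangent M)).

Definition loc_energy F (c : chart M) : tm_coords R n -> R := energy (loc_fun F c).

Record finsler F : Prop := Finsler {
  finsler_ge0 : forall u, 0 <= F u;
  finsler_smooth : forall c, smooth (loc_set (@slit _ _ M) c) (loc_fun F c);
  finsler_cont : forall c z, loc_set setT c z -> {for z, continuous (loc_fun F c)};
  finsler_homo : forall (a : R) u, 0 < a -> F (tangent_scale a u) = a * F u;
  finsler_rank : forall c z, loc_set (@slit _ _ M) c z ->
    maximal_rank (ddJ (loc_energy F c) z) }.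

Record conic D : Prop := Conic {
  conic_nonempty : D !=set0;
  conic_slit : D `<=` @slit _ _ M;
  conic_open : forall c, open (loc_set D c);
  conic_scale : forall (a : R) u, 0 < a -> D u -> D (tangent_scale a u);
  conic_onto : @footpoint _ _ M @` D = setT;
  conic_fibre : forall x : M,
    connected [set v | D (tangent_of (chart_at x) x v)] }.

Record conic_pseudo_finsler D F : Prop := ConicPseudoFinsler {
  cpf_conic : conic D;
  cpf_ge0 : forall u, D u -> 0 <= F u;
  cpf_smooth : forall c, smooth (loc_set D c) (loc_fun F c);
  cpf_homo : forall (a : R) u, 0 < a -> D u -> F (tangent_scale a u) = a * F u;
  cpf_rank : forall c z, loc_set D c z ->
    maximal_rank (ddJ (loc_energy F c) z) }.

(* [G c] is the coordinate expression in the chart [c]; the three conditions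
   determine it on the coordinate expression of [D]. *)
Definition geodesic_spray D F (G : chart M -> tm_coords R n -> tm_coords R n) : Prop :=
  forall c, geodesic_spray_on (loc_set D c) (loc_energy F c) (G c).

Definition concurrent D F (G : chart M -> tm_coords R n -> tm_coords R n)
    (phi : tangent M -> tangent M) : Prop :=
  [/\ pi_vector_field D phi,
      forall u, D u -> slit (phi u) &
      forall c, concurrent_on (loc_set D c) (loc_energy F c) (G c)
                  (loc_field phi c)].

(* g_u(v, w) for v, w tangent at the footpoint of u, computed in a chart. *)
Definition gmetric F (u v w : tangent M) : R :=
  let c := chart_at (footpoint u) in
  metric (loc_energy F c) (tm_coord c u) (component v c) (component w c).

End Finsler.

(* Main.v *)
Require Import Defs.
From HB Require Import structures.
From mathcomp Require Import all_boot all_order all_algebra.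
From mathcomp Require Import all_classical all_reals all_analysis.
Import Order.TTheory GRing.Theory Num.Theory numFieldNormedType.Exports.
Local Open Scope classical_set_scope.
Local Open Scope ring_scope.
Set Implicit Arguments.
Unset Strict Implicit.
Unset Printing Implicit Defensive.

(* In coordinates, concurrency gives d phi / dy = 0 and (from D°_{beta W} phi = - W
   with W = etabar) beta phi = (phi, y + y^j d_j phi), which does not involve the
   spray. Hence beta phi and its hatted analogue are the same vector field H. Each
   energy is constant along its own horizontal directions, so H.E = H.Ehat = 0;
   as Ehat is a function of E and Phi that is strictly monotone in Phi, H.Phi = 0.
   On the other hand Phi = gamma phi.E and [H, gamma phi] = - gamma phi, so
   H.Phi = - Phi. Thus Phi = 0 on the open set D, and differentiating vertically
   g(phi, .) = 0, contradicting nondegeneracy. *)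

(** * Directional derivatives *)

Lemma is_deriveP (R : numFieldType) (V W : normedModType R) (f : V -> W)
    (x v : V) (l : W) :
  is_derive x v f l <->
  (fun h : R => h^-1 *: ((f \o shift x) (h *: v) - f x)) @ 0^' --> l.
Proof.
split=> [[df <-]|fl]; first exact: df.
by apply: DeriveDef; [apply/cvg_ex; exists l|exact: cvg_lim fl].
Qed.

Lemma diff_is_derive (R : numFieldType) (V W : normedModType R) (f : V -> W)
    (x v : V) : differentiable f x -> is_derive x v f ('D_v f x).
Proof. by move=> df; apply/derivableP/diff_derivable. Qed.

Lemma deriveDv (R : numFieldType) (V W : normedModType R) (f : V -> W)
    (x u v : V) : differentiable f x -> 'D_(u + v) f x = 'D_u f x + 'D_v f x.
Proof. by move=> df; rewrite !deriveE// linearD. Qed.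

Lemma deriveZv (R : numFieldType) (V W : normedModType R) (f : V -> W)
    (x v : V) (k : R) : differentiable f x -> 'D_(k *: v) f x = k *: 'D_v f x.
Proof. by move=> df; rewrite !deriveE// linearZ. Qed.

Lemma is_derive_pair (R : numFieldType) (U V W : normedModType R)
    (f : U -> V) (g : U -> W) (x v : U) df dg :
  is_derive x v f df -> is_derive x v g dg ->
  is_derive x v (fun t => (f t, g t)) (df, dg).
Proof. by move=> /is_deriveP df' /is_deriveP dg'; apply/is_deriveP/cvg_pair. Qed.

Lemma is_derive_fst (R : numFieldType) (U V W : normedModType R)
    (f : U -> V * W) (x v : U) df :
  is_derive x v f df -> is_derive x v (fun t => (f t).1) df.1.
Proof.
move=> /is_deriveP fl; apply/is_deriveP.
by apply: (@cvg_comp _ _ _ _ (@fst V W) _ _ _ fl); exact: cvg_fst.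
Qed.

Lemma is_derive_snd (R : numFieldType) (U V W : normedModType R)
    (f : U -> V * W) (x v : U) df :
  is_derive x v f df -> is_derive x v (fun t => (f t).2) df.2.
Proof.
move=> /is_deriveP fl; apply/is_deriveP.
by apply: (@cvg_comp _ _ _ _ (@snd V W) _ _ _ fl); exact: cvg_snd.
Qed.

(** Product rule in the single direction [v]: the difference quotient is split by adding and
    subtracting [k (h *: v + x) *: f x]. *)
Lemma is_derive_scale (R : numFieldType) (V W : normedModType R)
    (k : V -> R) (f : V -> W) (x v : V) dk df :
  is_derive x v k dk -> is_derive x v f df ->
  is_derive x v (fun t => k t *: f t) (k x *: df + dk *: f x).
Proof.
move=> dk' df'; apply/is_deriveP.
rewrite [X in X @ _](_ : _ = fun h : R =>
  k (h *: v + x) *: (h^-1 *: (f (h *: v + x) - f x))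
  + (h^-1 *: (k (h *: v + x) - k x)) *: f x); last first.
  apply/funext => h /=; rewrite scalerA mulrC -scalerA -(scalerA _ _ (f x)).
  by rewrite -scalerDr; congr (_ *: _); rewrite scalerBr scalerBl addrA subrK.
apply: cvgD; last by apply: cvgZr_tmp; move/is_deriveP: dk'.
apply: cvgZ; last by move/is_deriveP: df'.
(* Derivability of [k] along [v] gives continuity on that line, which is what the first factor
   requires. *)
suff : {for 0, continuous (fun h : R => k (h *: v + x))}.
  by move=> /continuous_withinNx; rewrite scale0r add0r.
case: dk' => kd _.
exact/differentiable_continuous/derivable1_diffP/(derivable1P _ _ _).1.
Qed.

(** The direction [L (Y t)] moves with the point. Expanding [Y t] in the standard basis leaves a
    finite sum of scalar functions times derivatives in fixed directions, to which the product rule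
    applies. *)
Lemma derive_along_lin (R : realType) (U W : normedModType R) (m : nat)
    (L : {linear 'rV[R]_m -> U}) (Y : U -> 'rV[R]_m) (f : U -> W) (x v : U) dY :
  (\forall t \near x, differentiable f t) ->
  (forall a, derivable ('D_a f) x v) ->
  is_derive x v Y dY ->
  is_derive x v (fun t => 'D_(L (Y t)) f t)
    ('D_v ('D_(L (Y x)) f) x + 'D_(L dY) f x).
Proof.
move=> df ddf [Yd YdE].
have dE t y : differentiable f t ->
    'D_(L y) f t = \sum_(i < m) y 0 i *: 'D_(L (delta_mx 0 i)) f t.
  move=> dft; rewrite deriveE// {1}(row_sum_delta y) linear_sum linear_sum.
  by apply: eq_bigr => i _; rewrite linearZ linearZ deriveE.
have sumE (Z : U -> 'rV[R]_m) dZ : is_derive x v Z dZ ->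
    is_derive x v (fun t => 'D_(L (Z t)) f t)
     (\sum_(i < m) (Z x 0 i *: 'D_v ('D_(L (delta_mx 0 i)) f) x
                    + dZ 0 i *: 'D_(L (delta_mx 0 i)) f x)).
  move=> [Zd ZdE].
  apply: (@near_eq_is_derive _ _ _
     (\sum_(i < m) (fun t => Z t 0 i *: 'D_(L (delta_mx 0 i)) f t))).
    near=> t; rewrite dE; last by near: t.
    by rewrite fct_sumE.
  apply: is_derive_sum => i; apply: is_derive_scale; last exact/derivableP.
  apply: DeriveDef; first by move/derivable_mxP: Zd; apply.
  by rewrite -ZdE derive_mx// mxE.
apply: is_derive_eq (sumE _ _ (DeriveDef Yd YdE)) _.
rewrite big_split /=; congr (_ + _); last by rewrite dE//; exact: nbhs_singleton df.
(* The same expansion for the direction frozen at [Y x] identifies the remaining sum as a second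
   derivative. *)
have [_ ->] := sumE (cst (Y x)) 0 (is_derive_cst _ _ _).
by apply: eq_bigr => i _; rewrite mxE scale0r addr0.
Unshelve. all: by end_near. Qed.

(** [tm_coords] is a pair of row spaces, so the direction is split into its two halves, embedded by
    the linear maps [L1] and [L2]. *)
Lemma derive_along (R : realType) (n : nat) (W : normedModType R)
    (X : tm_coords R n -> tm_coords R n) (f : tm_coords R n -> W)
    (x v dX : tm_coords R n) :
  (\forall t \near x, differentiable f t) ->
  (forall a, derivable ('D_a f) x v) ->
  is_derive x v X dX ->
  is_derive x v (fun t => 'D_(X t) f t) ('D_v ('D_(X x) f) x + 'D_dX f x).
Proof.
move=> df ddf Xd.
have lin1 : linear (fun w : 'rV[R]_n => (w, 0) : tm_coords R n).
  by move=> k a b; congr (_, _); rewrite /= scaler0 addr0.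
have lin2 : linear (fun w : 'rV[R]_n => (0, w) : tm_coords R n).
  by move=> k a b; congr (_, _); rewrite /= scaler0 addr0.
pose M1 := GRing.isLinear.Build _ _ _ _ _ lin1.
pose L1 : {linear _ -> _} := HB.pack (fun w : 'rV[R]_n => (w, 0) : tm_coords R n) M1.
pose M2 := GRing.isLinear.Build _ _ _ _ _ lin2.
pose L2 : {linear _ -> _} := HB.pack (fun w : 'rV[R]_n => (0, w) : tm_coords R n) M2.
have split_dir t a : differentiable f t ->
    'D_a f t = 'D_(L1 a.1) f t + 'D_(L2 a.2) f t.
  move=> dft; rewrite -deriveDv//; congr ('D_ _ f t).
  by case: a => a1 a2; congr (_, _); rewrite /= ?addr0 ?add0r.
have dfx := nbhs_singleton df.
have E1 := derive_along_lin L1 df ddf (is_derive_fst Xd).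
have E2 := derive_along_lin L2 df ddf (is_derive_snd Xd).
apply: (@near_eq_is_derive _ _ _
  ((fun t => 'D_(L1 (X t).1) f t) + (fun t => 'D_(L2 (X t).2) f t))).
  near=> t; rewrite [RHS]split_dir//; by near: t.
apply: is_derive_eq (is_deriveD E1 E2) _.
rewrite addrACA -split_dir//; congr (_ + _).
rewrite -deriveD//; apply: near_eq_derive.
near=> t; rewrite [RHS]split_dir//; by near: t.
Unshelve. all: by end_near. Qed.

(** * Mean values and symmetry of second derivatives *)

Lemma MVT_line (R : realType) (V : normedModType R) (f : V -> R) (x a : V) (h : R) :
  0 < h -> (forall s, 0 <= s <= h -> differentiable f (x + s *: a)) ->
  exists2 s, 0 <= s <= h & f (x + h *: a) - f x = h * 'D_a f (x + s *: a).
Proof.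
move=> h0 df; pose g (s : R) := f (x + s *: a).
have dg s : 0 <= s <= h -> is_derive s 1 g ('D_a f (x + s *: a)).
  move=> /df dfs; apply/is_deriveP.
  suff <- : (fun k : R => k^-1 *: ((f \o shift (x + s *: a)) (k *: a) - f (x + s *: a)))
          = (fun k : R => k^-1 *: ((g \o shift s) (k *: 1) - g s)).
    by apply/is_deriveP; exact: diff_is_derive.
  apply/funext => k /=.
  by rewrite /g [k *: a + _]addrCA scalerDl [_ *: 1]mulr1.
have [||s] := @MVT_segment _ g (fun s => 'D_a f (x + s *: a)) 0 h (ltW h0).
- by move=> s /itvP sh; apply: dg; rewrite !sh.
- apply: derivable_within_continuous => s; rewrite in_itv /= => sh.
  by case: (dg _ sh).
by rewrite in_itv /= => sh; rewrite /g scale0r addr0 subr0 mulrC => E; exists s.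
Qed.

(** The mean value theorem is applied twice: to $y\mapsto f(y+hb)-f(y)$ along [a], then to ['D_a f]
    along [b]. *)
Lemma second_difference (R : realType) (V : normedModType R) (f : V -> R)
    (x a b : V) (h : R) : 0 < h ->
  (forall s t, 0 <= s <= h -> 0 <= t <= h ->
     differentiable f (x + s *: a + t *: b)
     /\ differentiable ('D_a f) (x + s *: a + t *: b)) ->
  exists s t, [/\ 0 <= s <= h, 0 <= t <= h &
    f (x + h *: a + h *: b) - f (x + h *: a) - (f (x + h *: b) - f x)
    = h * (h * 'D_b ('D_a f) (x + s *: a + t *: b))].
Proof.
move=> h0 df.
have hh : 0 <= h <= h by rewrite lexx ltW.
have zh : 0 <= (0 : R) <= h by rewrite lexx ltW.
pose g y := f (y + h *: b) - f y.
have dsh y : differentiable f (y + h *: b) ->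
    differentiable (fun t => f (t + h *: b)) y.
  move=> dfy; apply: (@differentiable_comp _ _ _ _ (fun t => t + h *: b) f) => //.
have dg s : 0 <= s <= h -> is_derive (x + s *: a) a g
    ('D_a f (x + s *: a + h *: b) - 'D_a f (x + s *: a))
    /\ differentiable g (x + s *: a).
  move=> sh; have [d1 _] := df _ _ sh hh; have [d2 _] := df _ _ sh zh.
  rewrite scale0r addr0 in d2.
  split; last by apply: differentiableB => //; exact: dsh.
  apply: (@is_deriveB _ _ _ (fun t => f (t + h *: b)) f); last exact: diff_is_derive.
  have /is_deriveP d1a := diff_is_derive a d1; apply/is_deriveP.
  suff -> : (fun k : R => k^-1 *:
        (((fun t => f (t + h *: b)) \o shift (x + s *: a)) (k *: a)
         - f (x + s *: a + h *: b))) =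
      (fun k : R => k^-1 *: ((f \o shift (x + s *: a + h *: b)) (k *: a)
         - f (x + s *: a + h *: b))) by [].
  by apply/funext => k /=; rewrite -(addrA _ _ (h *: b)).
have [s sh E] := MVT_line h0 (fun s sh => (dg s sh).2).
have [t th E'] := MVT_line h0
                   (fun t th => (df s t sh th).2).
exists s, t; split=> //; rewrite -E' -[LHS]/(g (x + h *: a) - g x) E.
by congr (_ * _); have [[_ ->] _] := dg _ sh.
Qed.

(** The second difference over a small parallelogram is symmetric in [a] and [b], so the two mixed
    derivatives take a common value at two points near [x]; continuity carries this to [x]. *)
Lemma derive_comm (R : realType) (V : normedModType R) (f : V -> R) (x a b : V) :
  (\forall t \near x, differentiable f t) ->
  (\forall t \near x, differentiable ('D_a f) t) ->
  (\forall t \near x, differentiable ('D_b f) t) ->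
  {for x, continuous ('D_b ('D_a f))} -> {for x, continuous ('D_a ('D_b f))} ->
  'D_a ('D_b f) x = 'D_b ('D_a f) x.
Proof.
move=> df dfa dfb cab cba.
apply/eqP; rewrite eq_sym -subr_eq0 -normr_le0; apply/ler_addgt0Pl => e e0.
rewrite addr0.
have e20 : 0 < e / 2 by rewrite divr_gt0.
have : \forall t \near x, [/\ [/\ differentiable f t, differentiable ('D_a f) t &
    differentiable ('D_b f) t], `|'D_b ('D_a f) x - 'D_b ('D_a f) t| < e / 2 &
    `|'D_a ('D_b f) x - 'D_a ('D_b f) t| < e / 2].
  move/cvgrPdist_lt : cab => /(_ _ e20) cab; move/cvgrPdist_lt : cba => /(_ _ e20) cba.
  apply: filterS (filterI (filterI df (filterI dfa dfb)) (filterI cab cba)).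
  by move=> t [[d1 [d2 d3]] [c1 c2]]; exact: And3 (And3 d1 d2 d3) c1 c2.
move=> /nbhs_ballP[r /= r0 xr].
(* This size keeps the parallelogram inside the ball; the summand 1 keeps the denominator positive
   when both directions vanish. *)
pose h := r / (`|a| + `|b| + 1).
have ab0 : 0 < `|a| + `|b| + 1 by rewrite ltr_wpDl ?addr_ge0.
have h0 : 0 < h by rewrite divr_gt0.
have inb s t : 0 <= s <= h -> 0 <= t <= h -> ball x r (x + s *: a + t *: b).
  move=> /andP[s0 sh] /andP[t0 th]; rewrite -ball_normE /= -addrA opprD addNKr normrN.
  rewrite (le_lt_trans (ler_normD _ _))// !normrZ !ger0_norm//.
  have : s * `|a| + t * `|b| <= h * `|a| + h * `|b| by rewrite lerD// ler_wpM2r.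
  move/le_lt_trans; apply.
  have -> : r = h * (`|a| + `|b| + 1) by rewrite mulfVK// gt_eqF.
  by rewrite !mulrDr mulr1 ltrDl.
have [|s [t [sh th E]]] := @second_difference _ _ f x a b h h0.
  by move=> s t sh th; have [[? ? ?] _ _] := xr _ (inb _ _ sh th).
have [|t' [s' [th' sh' E']]] := @second_difference _ _ f x b a h h0.
  move=> t' s' th' sh'; rewrite addrAC.
  by have [[? ? ?] _ _] := xr _ (inb _ _ sh' th').
have [_ P1 _] := xr _ (inb _ _ sh th).
have [_ _ P2] := xr _ (inb _ _ sh' th').
rewrite (addrAC x (s' *: a)) in P2.
have Q : 'D_b ('D_a f) (x + s *: a + t *: b)
       = 'D_a ('D_b f) (x + t' *: b + s' *: a).
  apply: (mulfI (lt0r_neq0 h0)); apply: (mulfI (lt0r_neq0 h0)).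
  refine (etrans (esym E) (etrans _ E')); rewrite (addrAC x (h *: b)).
  by rewrite !opprD !opprK addrACA.
rewrite (splitr e) -(subrKA ('D_b ('D_a f) (x + s *: a + t *: b))).
apply: le_trans (ler_normD _ _) _; apply: lerD; apply: ltW; first exact: P1.
rewrite Q distrC; exact: P2.
Qed.

(** * Smooth maps *)

(** The differential of [f] at [x] also serves for [g], because the two remainders agree near
    [x]. *)
Lemma near_eq_differentiable (R : realType) (V W : normedModType R)
    (f g : V -> W) (x : V) :
  (\forall t \near x, f t = g t) -> differentiable f x -> differentiable g x.
Proof.
move=> fg df; have [dc /eqaddoP fo] := (diff_locallyP _ _).1 df.
have go : g \o shift x = cst (g x) + 'd f x +o_ 0 id.
  apply/eqaddoP => e e0; near=> h.
  have -> : (g \o shift x - (cst (g x) + 'd f x)) h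
          = (f \o shift x - (cst (f x) + 'd f x)) h.
    rewrite /= /GRing.add /= -(nbhs_singleton fg); congr (_ + _).
    apply/esym; near: h; have := fg; rewrite (near_shift 0) /= subr0.
    by apply: filterS => t /=; rewrite /shift.
  by near: h; exact: fo.
apply/diff_locallyP; rewrite (diff_unique dc go); split=> //.
Unshelve. all: by end_near. Qed.

Lemma classC_subset (R : realType) (V W : normedModType R) (k : nat)
    (A B : set V) (f : V -> W) : A `<=` B -> classC k B f -> classC k A f.
Proof.
move=> AB; elim: k f => [|k IH] f /=; first by move=> h x /AB; exact: h.
by move=> [df ddf]; split=> [x /AB|v]; [exact: df|exact/IH/ddf].
Qed.

Lemma classC_eq (R : realType) (V W : normedModType R) (k : nat)
    (A : set V) (f g : V -> W) : open A -> (forall x, A x -> f x = g x) ->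
  classC k A f -> classC k A g.
Proof.
move=> oA; elim: k f g => [|k IH] f g fg /=.
  move=> cf x Ax; have nfg : {near x, f =1 g}.
    by apply: filterS (open_nbhs_nbhs (conj oA Ax)) => t /fg.
  rewrite /prop_for /continuous_at -(fg _ Ax).
  exact: cvg_trans (near_eq_cvg nfg) (cf _ Ax).
move=> [df ddf]; have nfg x : A x -> \near x, f x = g x.
  by move=> Ax; apply: filterS (open_nbhs_nbhs (conj oA Ax)) => t /fg.
split=> [x Ax|v]; last first.
  by apply: IH (ddf v) => x /nfg; exact: near_eq_derive.
exact: near_eq_differentiable (nfg _ Ax) (df _ Ax).
Qed.

Lemma smooth_subset (R : realType) (V W : normedModType R) 
    (A B : set V) (f : V -> W) : A `<=` B -> smooth B f -> smooth A f.
Proof. by move=> AB sf k; exact: classC_subset (sf k). Qed.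

Lemma smooth_diff (R : realType) (V W : normedModType R) (A : set V) (f : V -> W) x :
  smooth A f -> A x -> differentiable f x.
Proof. by move=> /(_ 1%N)[+ _]; apply. Qed.

Lemma smooth_derive (R : realType) (V W : normedModType R) (A : set V) (f : V -> W) v :
  smooth A f -> smooth A ('D_v f).
Proof. by move=> sf k; have [_] := sf k.+1; apply. Qed.

Lemma smooth_diff_near (R : realType) (V W : normedModType R) (A : set V)
    (f : V -> W) x : open A ->
  smooth A f -> A x -> \forall t \near x, differentiable f t.
Proof.
move=> oA sf Ax; apply: filterS (open_nbhs_nbhs (conj oA Ax)) => t.
exact: smooth_diff.
Qed.

Lemma smooth_cst (R : realType) (V W : normedModType R) (A : set V) (w : W) :
  smooth A (cst w : V -> W).
Proof.
(* The derivative of a constant is the zero constant, so the induction is first closed on zero. *)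
have cst0 k : classC k A (cst 0 : V -> W).
  elim: k => [|k IH] /=; first by move=> x _; exact: cst_continuous.
  split=> [x _|v]; first exact: differentiable_cst.
  by rewrite (_ : (fun _ => _) = cst 0)//; apply/funext => x; rewrite derive_cst.
case=> [|k] /=; first by move=> x _; exact: cst_continuous.
split=> [x _|v]; first exact: differentiable_cst.
by rewrite (_ : (fun _ => _) = cst 0)//; apply/funext => x; rewrite derive_cst.
Qed.

Lemma smooth_derive_comm (R : realType) (V : normedModType R) (A : set V)
    (f : V -> R) x a b : open A -> smooth A f -> A x ->
  'D_a ('D_b f) x = 'D_b ('D_a f) x.
Proof.
move=> oA sf Ax; have sd v := smooth_derive v sf.
apply: derive_comm.
- exact: smooth_diff_near sf Ax.
- exact: smooth_diff_near (sd a) Ax.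
- exact: smooth_diff_near (sd b) Ax.
- exact: (smooth_derive b (sd a) 0%N).
- exact: (smooth_derive a (sd b) 0%N).
Qed.

Lemma smooth_energy (R : realType) (n : nat) (A : set (tm_coords R n))
    (F : tm_coords R n -> R) : open A -> smooth A F -> smooth A (energy F).
Proof.
move=> oA sF; have classCD k (f g : tm_coords R n -> R) :
    classC k A f -> classC k A g -> classC k A (f + g).
  elim: k f g => [|k IH] f g /=.
    by move=> cf cg x Ax; apply: continuousD; [exact: cf|exact: cg].
  move=> [df ddf] [dg ddg]; split=> [x Ax|v].
    by apply: differentiableD; [exact: df|exact: dg].
  apply: classC_eq (IH _ _ (ddf v) (ddg v)) => // x Ax.
  by rewrite deriveD//; apply: diff_derivable; [exact: df|exact: dg].
(* Both factors are taken smooth, a property inherited by their derivatives, so the induction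
   hypothesis covers both terms of the Leibniz rule. *)
have classCM k (f g : tm_coords R n -> R) :
    smooth A f -> smooth A g -> classC k A (f * g).
  elim: k f g => [|k IH] f g sf sg /=.
    by move=> x Ax; apply: continuousM; [exact: (sf 0%N)|exact: (sg 0%N)].
  split=> [x Ax|v].
    by apply: differentiableM; [exact: smooth_diff Ax|exact: smooth_diff Ax].
  apply: (@classC_eq _ _ _ _ _ (f * 'D_v g + g * 'D_v f)) => // [x Ax|].
    by rewrite deriveM//; apply: diff_derivable; exact: smooth_diff Ax.
  by apply: classCD; apply: IH => //; exact: smooth_derive.
have -> : energy F = cst 2^-1 * (F * F) by apply/funext => x; rewrite /energy expr2.
move=> k; apply: (classCM); first exact: smooth_cst.
by move=> j; apply: (classCM).
Qed.

(** * Sprays in coordinates *)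

Lemma is_derive_val (R : numFieldType) (V W : normedModType R) (f : V -> W)
    (x v : V) (l : W) : is_derive x v f l -> 'D_v f x = l.
Proof. by case. Qed.

Section Spray.
Variables (R : realType) (n : nat).
Notation V := 'rV[R]_n.
Notation P := (tm_coords R n).
Variable U : set P.
Hypothesis oU : open U.

Lemma smooth_derive_along (W : normedModType R) (f : P -> W) (X : P -> P) x v dX :
  smooth U f -> U x -> is_derive x v X dX ->
  is_derive x v (fun t => 'D_(X t) f t) ('D_v ('D_(X x) f) x + 'D_dX f x).
Proof.
move=> sf Ux Xd; apply: derive_along Xd; first exact: smooth_diff_near Ux.
by move=> a; apply: diff_derivable; exact: smooth_diff (smooth_derive a sf) Ux.
Qed.

Lemma eq_is_derive (W : normedModType R) (f g : P -> W) x v df :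
  (forall t, U t -> f t = g t) -> U x -> is_derive x v f df -> is_derive x v g df.
Proof.
move=> fg Ux; apply: near_eq_is_derive.
by apply: filterS (open_nbhs_nbhs (conj oU Ux)) => t /fg.
Qed.

Lemma is_derive_gamma (f : P -> V) x v df :
  is_derive x v f df -> is_derive x v (fun t => gamma (f t)) (gamma df).
Proof. by move=> fd; apply: is_derive_pair fd; exact: is_derive_cst. Qed.

Lemma is_derive_liouville x v :
  is_derive x v (fun t : P => liouville t) (gamma v.2).
Proof. exact: is_derive_gamma (is_derive_snd (is_derive_id x v)). Qed.

Lemma gammaD (a b : V) : gamma (a + b) = gamma a + gamma b.
Proof. by rewrite -[RHS]/(0 + 0, a + b) addr0. Qed.

Lemma gammaZ (k : R) (a : V) : gamma (k *: a) = k *: gamma a.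
Proof. by rewrite -[RHS]/(k *: 0, k *: a) scaler0. Qed.

Lemma tm_coords_split (a : P) : a = (a.1, 0) + gamma a.2 :> P.
Proof. by case: a => a1 a2; rewrite -[RHS]/(a1 + 0, 0 + a2) addr0 add0r. Qed.

Variables (E : P -> R) (G : P -> P).
Hypothesis sE : smooth U E.
Hypothesis euler : forall z, U z -> 'D_(liouville z) E z = 2 * E z.
Hypothesis spray : geodesic_spray_on U E G.

Lemma spray_smooth : smooth U G.
Proof. by case: spray. Qed.

Lemma spray_fst z : U z -> (G z).1 = z.2.
Proof. by case: spray => _ h /h[/(congr1 snd)]. Qed.

Lemma derive_spray_fst a z : U z -> ('D_a G z).1 = a.2.
Proof.
move=> Uz; have dG := is_derive_fst (diff_is_derive a (smooth_diff spray_smooth Uz)).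
rewrite -(is_derive_val dG); apply: is_derive_val.
by apply: eq_is_derive Uz (is_derive_snd (is_derive_id _ _)) => t /spray_fst.
Qed.

Lemma bracket_cst (w : P) (X : P -> P) z : bracket (cst w) X z = 'D_w X z.
Proof.
have c0 : 'D_(X z) (cst w) z = 0 by exact: derive_cst.
by rewrite /bracket c0 subr0.
Qed.

Lemma barthelE a z : U z ->
  barthel G z a = (a.1, ('D_(gamma a.1) G z).2 - a.2).
Proof.
move=> Uz; rewrite /barthel !bracket_cst /J /rho (derive_spray_fst _ Uz).
have := derive_spray_fst (gamma a.1) Uz; case: ('D_(gamma a.1) G z) => d1 d2 /= ->.
by rewrite -[LHS]/(a.1 - 0, d2 - a.2) subr0.
Qed.

Lemma halfD (W : lmodType R) (w : W) : 2^-1 *: (w + w) = w.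
Proof. by rewrite scalerDr -scalerDl -[2^-1]mul1r -splitr scale1r. Qed.

Lemma vprojE a z : U z ->
  vproj G z a = gamma (a.2 - 2^-1 *: ('D_(gamma a.1) G z).2).
Proof.
move=> Uz; rewrite /vproj (barthelE _ Uz); case: a => a1 a2 /=.
move: ('D_(gamma a1) G z).2 => d.
rewrite -[LHS]/(2^-1 *: (a1 - a1), 2^-1 *: (a2 - (d - a2))).
by rewrite subrr scaler0 opprB addrA scalerBr halfD.
Qed.

Lemma hprojE a z : U z ->
  hproj G z a = (a.1, 2^-1 *: ('D_(gamma a.1) G z).2).
Proof.
move=> Uz; rewrite /hproj (barthelE _ Uz); case: a => a1 a2 /=.
move: ('D_(gamma a1) G z).2 => d.
by rewrite -[LHS]/(2^-1 *: (a1 + a1), 2^-1 *: (a2 + (d - a2))) halfD addrC subrK.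
Qed.

(** The vertical part is $-N^i_jw^j$, with $N^i_j$ the nonlinear connection coefficients of the
    spray. On [U] the set defining [beta] is a singleton, so the default value of [xget] never
    appears. *)
Lemma betaE w z : U z -> beta G z w = (w, 2^-1 *: ('D_(gamma w) G z).2).
Proof.
move=> Uz; apply: xget_unique => [|a [[b ->]]].
  by split; last by []; exists (w, 0); rewrite (hprojE _ Uz).
by rewrite (hprojE _ Uz) /rho /= => <-.
Qed.

(* The Euler-Lagrange equations, differentiated vertically, say that the energy
   is constant along horizontal directions. *)
Lemma derive_beta_energy w z : U z -> 'D_(beta G z w) E z = 0.
Proof.
move=> Uz; have dE := smooth_diff sE Uz.
have sprayE t b : U t ->
    'D_(G t) ('D_(gamma b.1) E) t - 'D_b ('D_(gamma t.2) E) t = - 'D_b E t.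
  by case: spray => _ h /h[JG _ /(_ b) <-]; rewrite /ddJ /dform /dJ JG.
(* With [b := G t] the two terms on the left of [sprayE] cancel: the energy is conserved along the
   spray. *)
have GE0 t : U t -> 'D_(G t) E t = 0.
  move=> Ut; have := sprayE t (G t) Ut; rewrite (spray_fst Ut) subrr => /eqP.
  by rewrite eq_sym oppr_eq0 => /eqP.
have EL : 'D_(G z) ('D_(gamma w) E) z - 'D_(w, 0) ('D_(gamma z.2) E) z
    = - 'D_(w, 0) E z := sprayE z (w, 0) Uz.
(* Euler's identity differentiated along [(w, 0)], a direction in which the Liouville field is
   constant. *)
have eul : 'D_(w, 0) ('D_(gamma z.2) E) z = 2 * 'D_(w, 0) E z.
  have /is_derive_val := smooth_derive_along sE Uz (is_derive_liouville z (w, 0)).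
  rewrite /= derive0 addr0 => <-; apply: is_derive_val.
  apply: (eq_is_derive _ Uz (is_deriveZ 2 (diff_is_derive (w, 0) dE))) => t Ut.
  by rewrite (euler Ut).
(* The vertical derivative of [GE0]; exchanging the two derivatives in its first term produces the
   first term of [EL]. *)
have dGE : 'D_(gamma w) ('D_(G z) E) z + 'D_('D_(gamma w) G z) E z = 0.
  have dG := diff_is_derive (gamma w) (smooth_diff spray_smooth Uz).
  rewrite -(is_derive_val (smooth_derive_along sE Uz dG)); apply: is_derive_val.
  by apply: (eq_is_derive _ Uz (is_derive_cst 0 _ _)) => t /GE0 ->.
rewrite (smooth_derive_comm _ _ oU sE Uz) in dGE.
(* ['D_(gamma w) G z] has first component [w], so the horizontal lift is its mean with [(w, 0)]. *)
have -> : beta G z w = 2^-1 *: ((w, 0) + 'D_(gamma w) G z).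
  rewrite (betaE _ Uz); have := derive_spray_fst (gamma w) Uz.
  case: ('D_(gamma w) G z) => d1 d2 /= ->.
  by rewrite -[RHS]/(2^-1 *: (w + w), 2^-1 *: (0 + d2)) halfD add0r.
rewrite (deriveZv _ _ dE) (deriveDv _ _ dE).
apply/eqP; rewrite scaler_eq0; apply/orP; right.
have alg (a x y b : R) : a - x = - y -> x = 2 * y -> a + b = 0 -> y + b == 0.
  by move=> /(canRL (subrK _)) -> ->; rewrite mulr_natl mulr2n addKr => ->.
exact: alg EL eul dGE.
Qed.

(** $[\mathcal C,G]=G$ makes the second component of [G] homogeneous of degree 2 in $y$.
    Differentiating its Euler identity along [gamma u] gives the claim: the first vertical
    derivatives have degree 1. *)
Lemma derive_derive_spray u z : U z ->
  ('D_(gamma u) ('D_(gamma z.2) G) z).2 = ('D_(gamma u) G z).2.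
Proof.
move=> Uz.
have homG t : U t -> 'D_(liouville t) G t = G t + gamma (G t).2.
  case: spray => _ h /h[_ + _] => /(canRL (subrK _)) ->; congr (_ + _).
  exact: is_derive_val (is_derive_liouville _ _).
have dG := diff_is_derive (gamma u) (smooth_diff spray_smooth Uz).
have A := smooth_derive_along spray_smooth Uz (is_derive_liouville z (gamma u)).
have B := is_deriveD dG (is_derive_gamma (is_derive_snd dG)).
have C := eq_is_derive (fun t Ut => esym (homG t Ut)) Uz B.
have := etrans (esym (is_derive_val A)) (is_derive_val C).
rewrite -[gamma (gamma u).2]/(gamma u) -[liouville z]/(gamma z.2).
move: ('D_(gamma u) ('D_(gamma z.2) G) z) ('D_(gamma u) G z) => p q.
by move=> /(congr1 snd) pq; apply: (addIr q.2); exact: pq.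
Qed.

(** * Consequences of the concurrency conditions for one spray *)

Variable phi : P -> V.
Hypothesis sphi : smooth U phi.

(** The first component of the bracket of [gamma w] with the horizontal lift of [phi] is the
    vertical derivative of [phi]. *)
Lemma berwald_v_cst w z : berwald_v U G (cst w) phi (cst 0) -> U z ->
  'D_(gamma w) phi z = 0.
Proof.
move=> + Uz => /(_ _ Uz); rewrite /bracket.
have dphi := diff_is_derive (gamma w) (smooth_diff sphi Uz).
have A := smooth_derive_along spray_smooth Uz (is_derive_gamma dphi).
have B := is_derive_pair dphi (is_deriveZ 2^-1 (is_derive_snd A)).
have hliftE t : U t -> (phi t, 2^-1 *: ('D_(gamma (phi t)) G t).2) = hlift G phi t.
  by move=> Ut; rewrite /hlift (betaE _ Ut).
have C := is_derive_val (eq_is_derive hliftE Uz B).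
have C0 : 'D_(hlift G phi z) (vlift (cst w)) z = 0 := derive_cst (gamma w) z _.
rewrite -[vlift (cst w) z]/(gamma w) C C0 subr0.
exact: esym.
Qed.

(** The bracket of [beta w] with [gamma phi] is vertical, so the vertical projector fixes it. Only
    the part [(w, 0)] of [beta w] acts on the vertically constant [phi]; the last term is the
    derivative of the connection coefficients along [gamma (phi z)]. *)
Lemma berwald_h_cst w z :
  (forall w, berwald_v U G (cst w) phi (cst 0)) ->
  berwald_h U G (cst w) phi (fun=> - w) -> U z ->
  'D_(w, 0) phi z =
    - w + 2^-1 *: ('D_(gamma (phi z)) ('D_(gamma w) G) z).2.
Proof.
move=> bv + Uz => /(_ _ Uz); rewrite /bracket (vprojE _ Uz).
have dphi := smooth_diff sphi Uz.
have A := is_derive_gamma (diff_is_derive (beta G z w) dphi).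
have dG := diff_is_derive (gamma (phi z))
  (smooth_diff (smooth_derive (gamma w) spray_smooth) Uz).
have B := is_derive_pair (is_derive_cst w z (gamma (phi z)))
  (is_deriveZ 2^-1 (is_derive_snd dG)).
have hliftE t : U t -> (w, 2^-1 *: ('D_(gamma w) G t).2) = hlift G (cst w) t.
  by move=> Ut; rewrite /hlift (betaE _ Ut).
have C := is_derive_val (eq_is_derive hliftE Uz B).
rewrite [X in (_ - X).2]C [X in (_ - X).1]C (is_derive_val A) /=.
rewrite subrr derive0 /= scaler0 subr0.
rewrite /hlift (betaE _ Uz) [X in 'D_X phi z](tm_coords_split _).
rewrite (deriveDv _ _ dphi) /= (berwald_v_cst (bv _) Uz) addr0.
by move=> /(congr1 snd) /= ->; rewrite subrK.
Qed.

Hypothesis bv : forall w, berwald_v U G (cst w) phi (cst 0).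
Hypothesis bh : forall w, berwald_h U G (cst w) phi (fun=> - w).

(** The horizontal condition for the constant field with value [z.2] brings in a second derivative
    of [G], which homogeneity lowers to the first derivative occurring in [beta]. The resulting lift
    is common to all sprays satisfying the same conditions. *)
Lemma beta_phiE z : U z -> beta G z (phi z) = (phi z, z.2 + 'D_(z.2, 0) phi z).
Proof.
move=> Uz; rewrite (betaE _ Uz); congr (_, _).
by rewrite (berwald_h_cst bv (bh _) Uz) (derive_derive_spray _ Uz) addNKr.
Qed.

(* [H, gamma phi] = - gamma phi and H.E = 0 for H := beta phi. *)
Lemma derive_beta_phi z : U z ->
  'D_(beta G z (phi z)) (fun t => 'D_(gamma (phi t)) E t) z
  = - 'D_(gamma (phi z)) E z.
Proof.
move=> Uz; set H := beta G z (phi z); set c := phi z.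
have dE := smooth_diff sE Uz; have dphi := smooth_diff sphi Uz.
have A := smooth_derive_along sE Uz (is_derive_gamma (diff_is_derive H dphi)).
rewrite (is_derive_val A) -/c {A}.
have -> : 'D_H phi z = - c + 2^-1 *: ('D_(gamma c) ('D_(gamma c) G) z).2.
  rewrite /H (betaE _ Uz) [X in 'D_X phi z](tm_coords_split _) (deriveDv _ _ dphi).
  by rewrite (berwald_v_cst (bv _) Uz) addr0 (berwald_h_cst bv (bh _) Uz).
set k := 2^-1 *: _.
have dG := diff_is_derive (gamma c)
  (smooth_diff (smooth_derive (gamma c) spray_smooth) Uz).
have B := is_derive_pair (is_derive_cst c z (gamma c))
  (is_deriveZ 2^-1 (is_derive_snd dG)).
(* The energy is constant along [beta G t c] at every [t] in [U], with [c] frozen; this is the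
   vertical derivative of that fact. It absorbs the [k] part of ['D_H phi z]. *)
have C : 'D_(gamma c) ('D_H E) z + 'D_(gamma k) E z = 0.
  have {}B : is_derive z (gamma c) (fun t => beta G t c) (gamma k).
    by apply: eq_is_derive Uz B => t Ut; rewrite (betaE _ Ut).
  rewrite -(is_derive_val (smooth_derive_along sE Uz B)); apply: is_derive_val.
  by apply: (eq_is_derive _ Uz (is_derive_cst 0 _ _)) => t Ut;
    rewrite (derive_beta_energy _ Ut).
rewrite (smooth_derive_comm _ _ oU sE Uz) gammaD -scaleN1r gammaZ.
rewrite (deriveDv _ _ dE) (deriveZv _ _ dE).
by rewrite scaleN1r addrCA C addr0.
Qed.

End Spray.

(** * Comparison of the two energies in one chart *)

Section LocalArgument.
Variables (R : realType) (n : nat).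
Notation V := 'rV[R]_n.
Notation P := (tm_coords R n).

Lemma geodesic_spray_on_subset (A B : set P) (E : P -> R) (G : P -> P) :
  A `<=` B -> geodesic_spray_on B E G -> geodesic_spray_on A E G.
Proof.
by move=> AB [sG hG]; split=> [|z /AB]; [exact: smooth_subset sG|exact: hG].
Qed.

Lemma J_gamma_derive (f : P -> R) (a : V) (b z : P) :
  'D_b (fun t => 'D_(J (gamma a)) f t) z = 0.
Proof.
have -> : (fun t => 'D_(J (gamma a)) f t) = cst 0 by apply/funext => t; exact: derive0.
exact: derive_cst.
Qed.

(** Contract $i_Gdd_JE=-dE$ with [gamma a] and use $JG=\mathcal C$; the terms containing $J\gamma
    a=0$ drop out. This turns $\Phi$ into the derivative of the energy along
    $\gamma\overline\varphi$. *)
Lemma metric_etabar (U : set P) (E : P -> R) (G : P -> P) (z : P) (a : V) :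
  geodesic_spray_on U E G -> U z -> metric E z a z.2 = 'D_(gamma a) E z.
Proof.
move=> [_ h] /h[JG _ S].
have {}S : 'D_(G z) (fun t => 'D_(J (gamma a)) E t) z
    - 'D_(gamma a) (fun t => 'D_(J (G z)) E t) z = - 'D_(gamma a) E z := S (gamma a).
rewrite (J_gamma_derive E a (G z) z) sub0r JG in S.
rewrite -[LHS]/('D_(gamma a) (fun t => 'D_(liouville z) E t) z
                - 'D_(z.2, 0) (fun t => 'D_(J (gamma a)) E t) z).
rewrite (J_gamma_derive E a (z.2, 0) z) subr0; exact: oppr_inj S.
Qed.

Lemma is_derive_energy (F : P -> R) (z v : P) : differentiable F z ->
  is_derive z v (energy F) (F z * 'D_v F z).
Proof.
move=> dF; have A := is_deriveM (diff_is_derive v dF) (diff_is_derive v dF).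
have -> : energy F = 2^-1 *: (F * F) by apply/funext => t; rewrite /energy expr2.
apply: is_derive_eq (is_deriveZ 2^-1 A) _.
exact: halfD.
Qed.

Variables (U : set P) (oU : open U).
Variables (F Fhat : P -> R) (G Ghat : P -> P) (phi : P -> V).
Hypotheses (sF : smooth U F) (sFhat : smooth U Fhat) (sphi : smooth U phi).
Hypothesis eulerF : forall z, U z -> 'D_(liouville z) (energy F) z = 2 * energy F z.
Hypothesis eulerFhat :
  forall z, U z -> 'D_(liouville z) (energy Fhat) z = 2 * energy Fhat z.
Hypotheses (sprayF : geodesic_spray_on U (energy F) G)
  (sprayFhat : geodesic_spray_on U (energy Fhat) Ghat).
Hypothesis bv : forall w, berwald_v U G (cst w) phi (cst 0).
Hypothesis bh : forall w, berwald_h U G (cst w) phi (fun=> - w).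
Hypothesis bvhat : forall w, berwald_v U Ghat (cst w) phi (cst 0).
Hypothesis bhhat : forall w, berwald_h U Ghat (cst w) phi (fun=> - w).
Variable Phi : P -> R.
Hypothesis PhiE : forall z, U z -> Phi z = 'D_(gamma (phi z)) (energy F) z.
Hypothesis Phi_lt : forall z, U z -> Phi z < F z.
Hypothesis FhatE : forall z, U z -> Fhat z = F z ^+ 2 / (F z - Phi z).

Lemma Phi_eq0 z : U z -> Phi z = 0.
Proof.
move=> Uz; have sE := smooth_energy oU sF; have sEhat := smooth_energy oU sFhat.
have dF := smooth_diff sF Uz; have dFhat := smooth_diff sFhat Uz.
pose H := beta G z (phi z).
have HE : H = beta Ghat z (phi z).
  rewrite /H (beta_phiE oU sprayF sphi bv bh Uz).
  by rewrite (beta_phiE oU sprayFhat sphi bvhat bhhat Uz).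
have FPhi t : U t -> F t - Phi t != 0.
  by move=> Ut; have := Phi_lt Ut; rewrite -subr_gt0; exact: lt0r_neq0.
(* If [F z] vanished, [Phi z], which equals [F z] times a derivative of [F], would vanish too,
   against [Phi z < F z]. *)
have F0 : F z != 0.
  apply/eqP => Fz0; have := Phi_lt Uz.
  by rewrite (PhiE Uz) (is_derive_val (is_derive_energy _ dF)) Fz0 mul0r ltxx.
have Fhat0 : Fhat z != 0.
  rewrite (FhatE Uz); apply: mulf_neq0; first exact: expf_neq0.
  by rewrite invr_eq0; exact: FPhi.
have HF : 'D_H F z = 0.
  have := derive_beta_energy oU sE eulerF sprayF (phi z) Uz.
  rewrite -/H (is_derive_val (is_derive_energy _ dF)) => /eqP.
  by rewrite mulf_eq0 (negbTE F0) => /eqP.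
have HFhat : 'D_H Fhat z = 0.
  have := derive_beta_energy oU sEhat eulerFhat sprayFhat (phi z) Uz.
  rewrite -HE (is_derive_val (is_derive_energy _ dFhat)) => /eqP.
  by rewrite mulf_eq0 (negbTE Fhat0) => /eqP.
have HPhi : is_derive z H Phi (- Phi z).
  have D := smooth_derive_along oU sE Uz
    (is_derive_gamma (diff_is_derive H (smooth_diff sphi Uz))).
  rewrite (PhiE Uz) -(derive_beta_phi oU sE eulerF sprayF sphi bv bh Uz).
  have PhiE' t : U t -> 'D_(gamma (phi t)) (energy F) t = Phi t by move=> /PhiE.
  exact: (eq_is_derive oU PhiE' Uz (is_derive_eq D (esym (is_derive_val D)))).
(* Differentiating $\widehat F(F-\Phi)=F^2$ along [H] leaves $\widehat F\Phi=0$. *)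
have A := is_deriveM (diff_is_derive H dFhat) (is_deriveB (diff_is_derive H dF) HPhi).
have B := is_deriveM (diff_is_derive H dF) (diff_is_derive H dF).
have FhatF t : U t -> (Fhat * (F - Phi)) t = (F * F) t.
  move=> Ut; rewrite -[LHS]/(Fhat t * (F t - Phi t)).
  by rewrite (FhatE Ut) (divfK (FPhi _ Ut)) expr2.
have := is_derive_val (eq_is_derive oU FhatF Uz A).
rewrite (is_derive_val B) HF HFhat !scaler0 addr0 addr0 sub0r opprK => /esym/eqP.
by rewrite scaler_eq0 (negbTE Fhat0) => /eqP.
Qed.

Lemma field_eq0 z : U z -> maximal_rank (ddJ (energy F) z) -> phi z = 0.
Proof.
move=> Uz rk; have sE := smooth_energy oU sF.
suff /(congr1 snd) : gamma (phi z) = 0 :> P by [].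
(* One term of the form dies by $J\gamma=0$. The other, after exchanging derivatives, is the
   derivative of [Phi] along [J b], since [phi] is vertically constant. *)
apply: rk => b; rewrite /ddJ /dform /dJ J_gamma_derive subr0.
rewrite (smooth_derive_comm _ _ oU sE Uz).
have dphi := diff_is_derive (J b) (smooth_diff sphi Uz).
have := is_derive_val (smooth_derive_along oU sE Uz (is_derive_gamma dphi)).
rewrite (berwald_v_cst oU sprayF sphi (bv _) Uz) derive0 addr0 => <-.
apply: is_derive_val.
by apply: (eq_is_derive oU _ Uz (is_derive_cst 0 _ _)) => t Ut;
  rewrite -(PhiE Ut) (Phi_eq0 Ut).
Qed.

End LocalArgument.

(** * Charts of the tangent bundle *)

(** A directional derivative is a limit taken along one line; the two lines may lie in different
    spaces, which allows comparison between charts. *)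
Lemma eq_derive_line (R : realType) (V V' W : normedModType R)
    (f : V -> W) (g : V' -> W) (x v : V) (x' v' : V') :
  (forall h : R, f (h *: v + x) = g (h *: v' + x')) -> 'D_v f x = 'D_v' g x'.
Proof.
move=> fg; have fg0 : f x = g x' by have := fg 0; rewrite !scale0r !add0r.
have E : (fun h : R => h^-1 *: ((f \o shift x) (h *: v) - f x)) =
         (fun h : R => h^-1 *: ((g \o shift x') (h *: v') - g x')).
  by apply/funext => h; rewrite /= fg fg0.
exact: (congr1 (fun k : R -> W => lim (k @ 0^')) E).
Qed.

Section Charts.
Variables (R : realType) (n : nat) (M : manifold R n).

Lemma tangent_eq (u v : tangent M) :
  footpoint u = footpoint v -> (forall e, component u e = component v e) -> u = v.
Proof.
case: u => x a p; case: v => y b q /= xy /funext ab.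
by case: _ / xy ab q => ab; case: _ / ab => q; congr Tangent; exact: Prop_irrelevance.
Qed.

Lemma tm_pointE (c : chart M) x v : chart_dom c x ->
  footpoint (tm_point c (chart_map c x, v)) = x /\
  forall e, component (tm_point c (chart_map c x, v)) e =
    if `[< chart_dom e x >] then 'd (transition c e) (chart_map c x) v else 0.
Proof.
move=> cx; rewrite /tm_point /= (chart_mapK cx); split=> // e.
by case: (asboolP (chart_dom e x)) => ex; [rewrite asboolT|rewrite asboolF// => -[]].
Qed.

Lemma component_line (c : chart M) (u w : tangent M) (s : R) :
  footpoint w = footpoint u -> chart_dom c (footpoint u) ->
  forall e, component (tm_point c (chart_map c (footpoint u),
                                   component u c + s *: component w c)) e =
            component u e + s *: component w e.
Proof.
move=> wu cu e; have [_ ->] := tm_pointE (component u c + s *: component w c) cu.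
have [lu zu] := tangentP u; have [lw zw] := tangentP w.
rewrite wu in lw zw; case: asboolP => eu.
  by rewrite linearD linearZ -(lu c e cu eu) -(lw c e cu eu).
by rewrite (zu _ eu) (zw _ eu) scaler0 addr0.
Qed.

(** Transition differentials are linear on fibres, so a vertical line is the same curve of $TM$ in
    both charts. Hence vertical derivatives are chart independent. *)
Lemma tm_point_line (c d : chart M) (u w : tangent M) (s : R) :
  footpoint w = footpoint u -> chart_dom c (footpoint u) -> chart_dom d (footpoint u) ->
  tm_point c (s *: gamma (component w c) + tm_coord c u) =
  tm_point d (s *: gamma (component w d) + tm_coord d u).
Proof.
move=> wu cu du.
have E e : s *: gamma (component w e) + tm_coord e u =
    (chart_map e (footpoint u), component u e + s *: component w e).
  rewrite -[LHS]/(s *: 0 + chart_map e (footpoint u),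
                    s *: component w e + component u e).
  by rewrite scaler0 add0r addrC.
rewrite !E; apply: tangent_eq => [|e]; last by rewrite !component_line.
by rewrite (tm_pointE _ cu).1 (tm_pointE _ du).1.
Qed.

Lemma tm_coordK (c : chart M) (u : tangent M) :
  chart_dom c (footpoint u) -> tm_point c (tm_coord c u) = u.
Proof.
move=> cu; apply: tangent_eq => [|e]; first exact: (tm_pointE _ cu).1.
have := component_line 0 (erefl (footpoint u)) cu e.
by rewrite !scale0r !addr0.
Qed.

Lemma tm_pointK (c : chart M) (z : tm_coords R n) :
  (chart_map c @` chart_dom c) z.1 -> tm_coord c (tm_point c z) = z.
Proof.
case: z => z1 v /= [x cx xz]; rewrite -xz {z1 xz}.
have [fx cE] := tm_pointE v cx; rewrite /tm_coord fx cE asboolT//.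
(* The transition from [c] to itself is the identity on the open coordinate domain, which determines
   its differential there. *)
have idE : \forall t \near chart_map c x, transition c c t = t.
  have img : (chart_map c @` chart_dom c) (chart_map c x) by exists x.
  have nb : nbhs (chart_map c x) (chart_map c @` chart_dom c).
    by apply: open_nbhs_nbhs; split; first exact: chart_img_open.
  apply: (filterS _ nb) => _ [y cy <-].
  by rewrite /transition /= (chart_mapK cy).
have dtr : differentiable (transition c c) (chart_map c x).
  have [+ _] := @transition_smooth _ _ M c c 1%N; apply; by exists x.
by rewrite -deriveE// (near_eq_derive _ idE) derive_id.
Qed.

(** Moving by [h] along the Liouville field scales the vector by [1 + h], so by homogeneity the
    difference quotient is constant for small nonzero [h]. *)
Lemma loc_fun_euler (D : set (tangent M)) (F : tangent M -> R) (c : chart M)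
    (z : tm_coords R n) :
  (forall (a : R) u, 0 < a -> D u -> F (tangent_scale a u) = a * F u) ->
  loc_set D c z -> is_derive z (liouville z) (loc_fun F c) (loc_fun F c z).
Proof.
move=> homF [_ Dz]; apply/is_deriveP.
apply: cvg_near_cst; near=> h.
have h1 : 0 < 1 + h.
  rewrite addrC -ltrBlDr sub0r; near: h; apply: cvg_within.
  by apply: open_nbhs_nbhs; split; [exact: open_gt|rewrite /= oppr_lt0].
have h0 : h != 0 by near: h; exact: nbhs_dnbhs_neq.
have pE : tm_point c (h *: liouville z + z) = tangent_scale (1 + h) (tm_point c z).
  have -> : h *: liouville z + z = (z.1, (1 + h) *: z.2).
    rewrite -[LHS]/(h *: 0 + z.1, h *: z.2 + z.2) scaler0 add0r addrC.
    by rewrite scalerDl scale1r.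
  apply: tangent_eq => // e /=; case: asboolP => _; last by rewrite scaler0.
  by rewrite linearZ.
rewrite /loc_fun /= pE (homF _ _ h1 Dz) mulrDl mul1r addrAC subrr add0r.
by rewrite /GRing.scale /= mulKf.
Unshelve. all: by end_near. Qed.

Lemma loc_energy_euler (D : set (tangent M)) (F : tangent M -> R) (c : chart M)
    (z : tm_coords R n) :
  (forall (a : R) u, 0 < a -> D u -> F (tangent_scale a u) = a * F u) ->
  differentiable (loc_fun F c) z -> loc_set D c z ->
  'D_(liouville z) (loc_energy F c) z = 2 * loc_energy F c z.
Proof.
move=> homF dF Dz; rewrite (is_derive_val (is_derive_energy _ dF)).
rewrite (is_derive_val (loc_fun_euler homF Dz)) /loc_energy /energy.
by rewrite mulrA mulfV ?pnatr_eq0// mul1r expr2.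
Qed.

(** [gmetric] is computed in the chart chosen by [chart_at]. There it is a vertical derivative of
    the energy, which transfers to any chart [c] around the point. *)
Lemma loc_gmetric (F : tangent M -> R) G (phi : tangent M -> tangent M)
    (c : chart M) (z : tm_coords R n) :
  geodesic_spray (@slit R n M) F G ->
  (forall u, slit u -> footpoint (phi u) = footpoint u) ->
  loc_set (@slit R n M) c z ->
  loc_fun (fun u => gmetric F u (phi u) u) c z
  = 'D_(gamma (loc_field phi c z)) (loc_energy F c) z.
Proof.
move=> sprayF fphi [cz sz]; rewrite /loc_fun /loc_field /gmetric.
have zK := tm_pointK cz; move: sz zK; set u := tm_point c z => su zK.
set d := chart_at _; have du : chart_dom d (footpoint u) by exact: chart_atP.
have cu : chart_dom c (footpoint u).
  by move: cz => [x cx xz]; rewrite /u /tm_point /= -xz chart_mapK.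
have sd : loc_set (@slit R n M) d (tm_coord d u).
  by split; [exists (footpoint u)|rewrite tm_coordK].
rewrite -[component u d]/((tm_coord d u).2) (metric_etabar _ (sprayF d) sd).
rewrite -zK; apply: eq_derive_line => h.
by rewrite /loc_energy /energy /loc_fun (tm_point_line h (fphi _ su) du cu).
Qed.

End Charts.

(** * From a single chart to the manifold *)

Theorem corollary3p6 (R : realType) (n : nat) (M : manifold R n)
    (F : tangent M -> R) (hF : finsler F)
    (G : chart M -> tm_coords R n -> tm_coords R n)
    (hG : geodesic_spray (@slit R n M) F G)
    (phi : tangent M -> tangent M)
    (hphi : concurrent (@slit R n M) F G phi) :
  let Phi := fun u : tangent M => gmetric F u (phi u) u in
  let p2 := fun u : tangent M => gmetric F u (phi u) (phi u) in
  let D := [set u : tangent M | Phi u < F u] in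
  let Fhat := fun u : tangent M => F u ^+ 2 / (F u - Phi u) in
  conic_pseudo_finsler D Fhat ->
  (forall u, D u -> F u * (1 + 2 * p2 u) - 3 * Phi u != 0) ->
  forall Ghat : chart M -> tm_coords R n -> tm_coords R n,
  geodesic_spray D Fhat Ghat ->
  ~ concurrent D Fhat Ghat phi.
Proof.
move=> Phi p2 D Fhat cpf _ Ghat hGhat hphihat.
have [u0 Du0] := conic_nonempty (cpf_conic cpf).
pose c := chart_at (footpoint u0).
have cu0 : chart_dom c (footpoint u0) by exact: chart_atP.
pose U := loc_set D c; pose z0 := tm_coord c u0.
have Uz0 : U z0 by split; [exists (footpoint u0)|rewrite tm_coordK].
have oU : open U by exact: (conic_open (cpf_conic cpf)).
have Us : U `<=` loc_set (@slit R n M) c.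
  by move=> z [cz Dz]; split=> //; exact: (conic_slit (cpf_conic cpf)).
have [[fphi sphi] phi0 conF] := hphi.
have [_ _ conFhat] := hphihat.
have sF : smooth U (loc_fun F c) := smooth_subset Us (finsler_smooth hF c).
have sFhat : smooth U (loc_fun Fhat c) := cpf_smooth cpf c.
have eulerF z (Uz : U z) : 'D_(liouville z) (energy (loc_fun F c)) z
                           = 2 * energy (loc_fun F c) z.
  apply: loc_energy_euler (smooth_diff sF Uz) (Us _ Uz) => a u a0 _.
  exact: finsler_homo.
have eulerFhat z (Uz : U z) : 'D_(liouville z) (energy (loc_fun Fhat c)) z
                              = 2 * energy (loc_fun Fhat c) z.
  exact: loc_energy_euler (cpf_homo cpf) (smooth_diff sFhat Uz) Uz.
have spF := geodesic_spray_on_subset Us (hG c).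
(* Concurrency is tested on fields with constant components in the chart. *)
have conc w := conF c (cst w) (smooth_cst _ w).
have conchat w := conFhat c (cst w) (smooth_cst _ w).
have bv w : berwald_v U (G c) (cst w) (loc_field phi c) (cst 0).
  by have [_ _ _ h] := conc w => z /Us; exact: h.
have bh w : berwald_h U (G c) (cst w) (loc_field phi c) (fun=> - w).
  by have [_ h _ _] := conc w => z /Us; exact: h.
have bvhat w : berwald_v U (Ghat c) (cst w) (loc_field phi c) (cst 0).
  by have [_ _ _ h] := conchat w.
have bhhat w : berwald_h U (Ghat c) (cst w) (loc_field phi c) (fun=> - w).
  by have [_ h _ _] := conchat w.
have PhiE z (Uz : U z) : loc_fun Phi c z
    = 'D_(gamma (loc_field phi c z)) (energy (loc_fun F c)) z.
  exact: loc_gmetric hG fphi (Us _ Uz).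
have Phi_lt z (Uz : U z) : loc_fun Phi c z < loc_fun F c z by case: Uz.
have FhatE z (Uz : U z) : loc_fun Fhat c z
    = loc_fun F c z ^+ 2 / (loc_fun F c z - loc_fun Phi c z) by [].
have := field_eq0 oU sF sFhat (smooth_subset Us (sphi c)) eulerF eulerFhat spF
  (hGhat c) bv bh bvhat bhhat PhiE Phi_lt FhatE Uz0 (finsler_rank hF (Us _ Uz0)).
rewrite /loc_field tm_coordK// => phic0.
have su0 := conic_slit (cpf_conic cpf) Du0.
(* Non-vanishing provides a nonzero component in some chart [e]. It is zero by convention if [e]
   misses the point, and otherwise by the transformation law from [c]. *)
have [e] := phi0 _ su0; move/eqP; apply.
have [law zero] := tangentP (phi u0); rewrite (fphi _ su0) in law zero.
case: (pselect (chart_dom e (footpoint u0))) => eu0; last exact: zero.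
by rewrite (law c e cu0 eu0) phic0 linear0.
Qed.
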